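(* Consider a Cayley-Klein space of dimension $n$ given by $Q_0,A_1,Q_1,\dots,A_r,Q_r,A_{r+1}=\varnothing$ (with $A_0=P^n(\mathbb{R})$) such that $A_1$ is a hyperplane of $P^n(\mathbb{R})$. Let $X$ be a point of $P^n(\mathbb{R})$ not in $A_1$. Then a line $L$ through $X$ is tangent to the absolute figure if and only if it passes through a point of $Q_1$.
   Context: Conventions. Subspaces are projective subspaces, including $\varnothing$ (of dimension $-1$) and the whole space; $\dim$ is projective dimension; $S+T$ is the smallest subspace containing $S$ and $T$; a point $X$ is identified with $\{X\}$. A hyperplane of a subspace $S$ is a subspace of $S$ of dimension $\dim S-1$. A set of points is independent if representing vectors are linearly independent; a set of hyperplanes is independent if the linear forms defining them are linearly independent. The intersection of the empty family of hyperplanes is the whole space. Quadrics. A quadric $Q$ in a real projective space $P(V)$ is the set $\{[x] : f(x,x)=0\}$ for a symmetric bilinear form $f$ on $V$ that is not identically zero; it is considered together with $f$. Points $[x],[y]$ are conjugate with respect to $Q$ if $f(x,y)=0$. The polar of a subspace $K$ with respect to $Q$ is the set of all points of $P(V)$ conjugate to every point of $K$. The vertex of $Q$ is the polar of $P(V)$; $Q$ is non-degenerate if its vertex is empty. Cayley-Klein space. Put $A_0=P^n(\mathbb{R})$. A Cayley-Klein space of dimension $n$ is $P^n(\mathbb{R})$ with a sequence $Q_0,A_1,Q_1,A_2,\dots,A_r,Q_r,A_{r+1}=\varnothing$ such that, for $0\le i\le r$, $Q_i$ is a quadric in $A_i$ with vertex $A_{i+1}$. Its absolute figure is the sequence of complex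 extensions $\hat Q_0\supseteq\hat A_1\supseteq\hat Q_1\supseteq\cdots\supseteq\hat A_r\supseteq\hat Q_r\supseteq\hat A_{r+1}=\varnothing$. Total polars. If $X$ is a point with $X\in A_l\setminus A_{l+1}$, a total polar of $X$ is a hyperplane of $P^n(\mathbb{R})$ containing $X^{p_l}$ (the polar of $X$ in $A_l$ with respect to $Q_l$). If $K$ is a $k$-dimensional subspace, a total polar of $K$ is an $(n-k-1)$-dimensional subspace of the form $\bigcap_{i=0}^k H_i$, where $\{X_0,\dots,X_k\}$ is some independent subset $B$ of $K$ with $|B\cap A_j|=\dim(K\cap A_j)+1$ for $0\le j\le r$, each $H_i$ is a total polar of $X_i$, and $\{H_0,\dots,H_k\}$ is independent. ($P^n(\mathbb{R})$ and $\varnothing$ are total polar to each other.) Tangency. A subspace $K$ of $P^n(\mathbb{R})$ is tangent to the absolute figure (a tangent subspace) if there exists a total polar $K^\perp$ of $K$ with $K\cap K^\perp\ne\varnothing$. *)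

(* Defs.v *)
From mathcomp Require Import all_boot all_order all_algebra.
From mathcomp Require Import reals.

Set Implicit Arguments.
Unset Strict Implicit.
Unset Printing Implicit Defensive.

Import Order.TTheory GRing.Theory Num.Theory.

Local Open Scope ring_scope.

(* The subspaces of P(V) are the vector subspaces of V, so that the projective
   dimension of K is (\dim K) - 1 and the empty subspace is 0%VS.  A point is
   given by a nonzero representing vector. *)

Section Quadrics.
Variables (R : realType) (V : vectType R).
Implicit Types (f : {symmetric V}) (K : {vspace V}).

Definition is_quadric_form f : Prop := exists x y : V, f x y != 0.

Definition on_quadric f (x : V) : Prop := x != 0 /\ f x x = 0.

Definition polar f K : {vspace V} := orthov f K.

Definition vertex f : {vspace V} := polar f fullv.

End Quadrics.

Section Subspaces.
Variables (R : realType) (V : vectType R).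
Implicit Types S H : {vspace V}.

(* The subspace U of P(S), viewed as a subspace of P(V). *)
Definition embed S (U : {vspace (subvs_of S)}) : {vspace V} :=
  (linfun (@vsval R V S) @: U)%VS.

Definition hyperplane_of S H : Prop := (H <= S)%VS /\ \dim S = (\dim H).+1.

Definition independent_hyperplanes (k : nat) (H : 'I_k -> {vspace V}) : Prop :=
  exists phi : k.-tuple 'Hom(V, R^o),
    free phi /\ forall i, H i = lker (tnth phi i).

End Subspaces.

(* The sequence Q_0, A_1, Q_1, ..., A_r, Q_r, A_(r+1) = 0 with r = ck_r; the
   quadric Q_i is given by its form on A_i.  Only the ck_A i with i <= r.+1 and
   the ck_form i with i <= r are meaningful. *)
Record ck_space (R : realType) (n : nat) := CKSpace {
  ck_r : nat;
  ck_A : nat -> {vspace 'rV[R]_n.+1};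
  ck_form : forall i, {symmetric subvs_of (ck_A i)};
  ck_A_first : ck_A 0 = fullv;
  ck_A_last : ck_A ck_r.+1 = 0%VS;
  ck_quadric : forall i, (i <= ck_r)%N -> is_quadric_form (ck_form i);
  ck_vertex : forall i, (i <= ck_r)%N -> embed (vertex (ck_form i)) = ck_A i.+1
}.

Section Tangency.
Variables (R : realType) (n : nat) (S : ck_space R n).
Local Notation V := 'rV[R]_n.+1.

Definition total_polar_point (X : V) (H : {vspace V}) : Prop :=
  hyperplane_of fullv H /\
  exists (l : nat) (x : subvs_of (ck_A S l)),
    [/\ (l <= ck_r S)%N, vsval x = X, X \notin ck_A S l.+1
      & (embed (polar (ck_form S l) <[x]>) <= H)%VS].

Definition total_polar (K P : {vspace V}) : Prop :=
  (\dim K + \dim P)%N = n.+1 /\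
  exists (B : (\dim K).-tuple V) (H : 'I_(\dim K) -> {vspace V}),
    [/\ free B /\ {subset B <= K},
        forall j, (j <= ck_r S)%N ->
          count (fun x => x \in ck_A S j) B = \dim (K :&: ck_A S j),
        forall i, total_polar_point (tnth B i) (H i),
        independent_hyperplanes H
      & P = (\bigcap_(i < \dim K) H i)%VS].

Definition tangent (K : {vspace V}) : Prop :=
  exists P : {vspace V}, total_polar K P /\ (K :&: P)%VS != 0%VS.

End Tangency.

(* Main.v *)
(* Let [Y] be the point where [L] meets [A_1].  A basis of [L] adapted to the
   flag consists of [Y] and a point off [A_1]; the only total polar of the latter
   is [A_1] itself, so [L] is tangent iff [Y] has a total polar through [Y] other
   than [A_1].  If [Y] is not on [Q_1], then [Y] and its polar span [A_1] and no
   such hyperplane exists; if it is, then [Y] and its polar in its level span a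
   proper subspace of [A_1], which extends to a hyperplane through [X]. *)

Require Import Defs.
From mathcomp Require Import all_boot all_order all_algebra.
From mathcomp Require Import reals.

Set Implicit Arguments.
Unset Strict Implicit.
Unset Printing Implicit Defensive.

Import GRing.Theory.

Local Open Scope ring_scope.

(** * Linear forms, their kernels and hyperplanes *)

Section LinearForms.
Variables (R : realType) (V : vectType R).
Implicit Types (U W : {vspace V}) (phi psi : 'Hom(V, R^o)).

(** The form reads the coordinate along [v] of the residue [w - projv W w], which vanishes for [w]
    in [W] and equals [v] at [u]. *)
Lemma separating_form W (u : V) : u \notin W ->
  exists phi, (W <= lker phi)%VS /\ phi u != 0.
Proof.
move=> uW; pose v := u - projv W u.
have v0 : v != 0.
  by rewrite subr_eq0; apply: contraNneq uW => ->; exact: memv_proj.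
pose c : 'Hom(V, R^o) := linfun (coord [tuple v] ord0 : V -> R^o).
have projE w : (c \o (\1 - projv W))%VF w = coord [tuple v] ord0 (w - projv W w).
  by rewrite comp_lfunE add_lfunE opp_lfunE id_lfunE lfunE.
exists (c \o (\1 - projv W))%VF; split.
  by apply/subvP => w wW; rewrite memv_ker projE projv_id // subrr linear0.
have fv : free [tuple v] by rewrite seq1_free.
by rewrite projE -/v (coord_free ord0 ord0 fv) oner_eq0.
Qed.

Lemma dim_cap_lker U phi (u : V) : u \in U -> phi u != 0 ->
  \dim U = (\dim (U :&: lker phi)).+1.
Proof.
move=> uU pu; rewrite -(limg_ker_dim phi U) -addn1; congr addn; apply/eqP.
rewrite eqn_leq; apply/andP; split.
  by apply: leq_trans (dimvS (subvf _)) _; rewrite dimvf.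
rewrite lt0n dimv_eq0; apply: contraNneq pu => p0.
by rewrite -memv0 -p0 memv_img.
Qed.

Lemma hyperplane_lker phi (u : V) : phi u != 0 -> hyperplane_of fullv (lker phi).
Proof.
by move=> pu; split; [exact: subvf | rewrite (dim_cap_lker (memvf u) pu) capfv].
Qed.

Lemma lker_sub_line phi psi : (lker phi <= lker psi)%VS -> psi \in <[phi]>%VS.
Proof.
move=> /subvP sub.
have [-> | /lfunPn[v]] := eqVneq psi 0; first exact: mem0v.
rewrite zero_lfunE => psiv.
have phiv : phi v != 0.
  by apply: contraNneq psiv => /eqP; rewrite -!memv_ker => /sub.
apply/vlineP; exists (psi v / phi v : R); apply/lfunP => w.
(* The multiple of [v] is chosen to cancel [phi w]; applying [psi] to the difference then gives the
   proportionality. *)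
have /sub : w - (phi w / phi v : R) *: v \in lker phi.
  rewrite memv_ker linearB linearZ /= subr_eq0; apply/eqP.
  by rewrite /GRing.scale /= divfK.
rewrite memv_ker linearB linearZ /= subr_eq0 => /eqP ->.
by rewrite scale_lfunE /GRing.scale /= mulrAC [phi w * _]mulrC mulrAC.
Qed.

(** Forms with equal kernels are proportional, which freeness forbids. This separates the two
    hyperplanes cutting out a total polar of a line. *)
Lemma independent_hyperplanes_neq (k : nat) (H : 'I_k -> {vspace V}) i j :
  independent_hyperplanes H -> i != j -> H i != H j.
Proof.
case=> phi [fphi HE] ij; apply/eqP; rewrite !HE => ker_eq.
have /vlineP[a pE] : tnth phi j \in <[tnth phi i]>%VS.
  by apply: lker_sub_line; rewrite ker_eq.
have := coord_free j j fphi; rewrite -tnth_nth pE linearZ /= (tnth_nth 0).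
by rewrite coord_free // eqxx (negPf ij) mulr0 => /eqP; rewrite eq_sym oner_eq0.
Qed.

Lemma hyperplane_eq (H K : {vspace V}) :
  hyperplane_of fullv H -> hyperplane_of fullv K -> (H <= K)%VS -> K = H.
Proof.
move=> [_ dH] [_ dK] HK; apply/esym/eqP; rewrite eqEdim HK /=.
by rewrite -ltnS -dH -dK.
Qed.

Lemma hyperplane_sub_eq (H K : {vspace V}) : hyperplane_of fullv H ->
  (H <= K)%VS -> ~~ (fullv <= K)%VS -> K = H.
Proof.
move=> [_ dH] HK nK; apply/esym/eqP; rewrite eqEdim HK -ltnS -dH ltn_neqAle.
by rewrite (dimv_leqif_sup (subvf K)).2 nK dimvS ?subvf.
Qed.

(** Because [x] is off [A], the intersection is a proper subspace of the two-dimensional [L], so it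
    has no room beyond [<[y]>]. *)
Lemma cap_line_eq (L A : {vspace V}) (x y : V) : \dim L = 2%N ->
  x \in L -> x \notin A -> y \in L -> y \in A -> y != 0 -> (L :&: A = <[y]>)%VS.
Proof.
move=> dL xL xA yL yA y0; apply/esym/eqP.
rewrite eqEdim -memvE memv_cap yL yA dim_vline y0 /= -ltnS -dL.
rewrite ltn_neqAle (dimvS (capvSl _ _)) andbT.
rewrite (dimv_leqif_eq (capvSl L A)).2.
by apply: contraNneq xA => LA; move: xL; rewrite -LA => /memv_capP[].
Qed.

End LinearForms.

(** * The flag of a Cayley-Klein space and the polars in its levels *)

Section CKSpaces.
Variables (R : realType) (n : nat) (S : ck_space R n).
Local Notation V := 'rV[R]_n.+1.

Lemma mem_embed (A : {vspace V}) (U : {vspace subvs_of A}) (u : subvs_of A) :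
  (vsval u \in embed U) = (u \in U).
Proof.
apply/memv_imgP/idP => [[w wU]|uU]; last by exists u; rewrite ?lfunE.
by rewrite lfunE /= => /subvs_inj ->.
Qed.

Lemma embed_sub (A : {vspace V}) (U : {vspace subvs_of A}) : (embed U <= A)%VS.
Proof. by apply/subvP => v /memv_imgP[w _ ->]; rewrite lfunE /= subvsP. Qed.

Lemma ck_A_subS i : (i <= ck_r S)%N -> (ck_A S i.+1 <= ck_A S i)%VS.
Proof. by move=> ir; rewrite -(ck_vertex ir) embed_sub. Qed.

Lemma ck_A_sub i j : (i <= j <= (ck_r S).+1)%N -> (ck_A S j <= ck_A S i)%VS.
Proof.
elim: j => [|j IH]; first by rewrite leqn0 => /andP[/eqP-> _]; exact: subvv.
case/andP; rewrite leq_eqVlt => /orP[/eqP-> _|ij jr]; first exact: subvv.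
by apply: subv_trans (ck_A_subS jr) (IH _); rewrite -ltnS ij ltnW.
Qed.

Lemma ck_A_succP i (u : subvs_of (ck_A S i)) : (i <= ck_r S)%N ->
  reflect (forall v, ck_form S i u v = 0) (vsval u \in ck_A S i.+1).
Proof.
move=> ir; rewrite -(ck_vertex ir) mem_embed.
apply: (iffP mem_orthovP) => [h v|h v _]; last exact: h.
by apply: h; exact: memvf.
Qed.

(** Otherwise the vertex would be all of [ck_A S i], and the form would be identically zero. *)
Lemma ck_A_proper i : (i <= ck_r S)%N -> ~~ (ck_A S i <= ck_A S i.+1)%VS.
Proof.
move=> ir; apply/negP => /subvP sub; have [u [v /eqP]] := ck_quadric ir.
by apply; apply/(ck_A_succP _ ir)/sub/subvsP.
Qed.

Lemma polar_proper i (x : subvs_of (ck_A S i)) : (i <= ck_r S)%N ->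
  vsval x \notin ck_A S i.+1 ->
  ~~ (ck_A S i <= embed (polar (ck_form S i) <[x]>))%VS.
Proof.
move=> ir; apply: contraNN => /subvP sub; apply/(ck_A_succP _ ir) => v.
apply/eqP; rewrite herm_eq0C -mem_orthov1 -mem_embed.
exact/sub/subvsP.
Qed.

Lemma ck_A_succ_sub_polar i (x : subvs_of (ck_A S i)) : (i <= ck_r S)%N ->
  (ck_A S i.+1 <= embed (polar (ck_form S i) <[x]>))%VS.
Proof.
move=> ir; rewrite -(ck_vertex ir); apply/subvP => w /memv_imgP[u uv ->].
rewrite lfunE /= mem_embed mem_orthov1; apply/eqP.
by move/mem_orthovP: uv; apply; exact: memvf.
Qed.

(** Orthogonal projection along the non-isotropic vector [y]: [w - a *: y] is conjugate to [y] for
    [a = f w y / f y y]. *)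
Lemma sub_polar_add (A : {vspace V}) (f : {symmetric subvs_of A})
    (y : subvs_of A) : f y y != 0 ->
  (A <= embed (polar f <[y]>) + <[vsval y]>)%VS.
Proof.
move=> fy; apply/subvP => v vA; pose w := vsproj A v.
have wE : vsval w = v by rewrite vsprojK.
pose a : R := f w y / f y y.
have -> : v = vsval (w - a *: y) + a *: vsval y.
  by rewrite -[v in LHS]wE /= subrK.
apply: memv_add; last by rewrite memvZ ?memv_line.
by rewrite mem_embed mem_orthov1 linearBl linearZl_LR /= divfK ?subrr.
Qed.

(** The least [m] with [x] outside [ck_A S m] is positive since the flag starts at the whole space,
    and at most [(ck_r S).+1] since it ends at 0; the level is [m - 1]. *)
Lemma ck_level (x : V) : x != 0 ->
  exists l, [/\ (l <= ck_r S)%N, x \in ck_A S l & x \notin ck_A S l.+1].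
Proof.
move=> x0; have ex : exists m, x \notin ck_A S m.
  by exists (ck_r S).+1; rewrite ck_A_last memv0.
case: (ex_minnP ex) => [[|l]] xl lmin; first by rewrite ck_A_first memvf in xl.
exists l; split=> //; last by apply/negPn/negP => /lmin; rewrite ltnn.
by rewrite -ltnS; apply: lmin; rewrite ck_A_last memv0.
Qed.

(** * Total polars when the first vertex is a hyperplane *)

Hypothesis hA1 : hyperplane_of fullv (ck_A S 1).

(** The polar contains the vertex [ck_A S 1] but is not the whole space, and a hyperplane leaves
    nothing strictly in between. *)
Lemma polar_off_A1 (x : subvs_of (ck_A S 0)) : vsval x \notin ck_A S 1 ->
  embed (polar (ck_form S 0) <[x]>) = ck_A S 1.
Proof.
move=> xA; apply: hyperplane_sub_eq hA1 (ck_A_succ_sub_polar _ (leq0n _)) _.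
by apply: contraNN (polar_proper (leq0n _) xA); apply: subv_trans (subvf _).
Qed.

Lemma total_polar_off_A1 (X : V) (H : {vspace V}) :
  X \notin ck_A S 1 -> total_polar_point S X H <-> H = ck_A S 1.
Proof.
move=> XA; split=> [[hH [[|l] [x [lr xX Xl sub]]]]|->].
- by apply: hyperplane_eq hA1 hH _; rewrite -(polar_off_A1 (x := x)) // xX.
- case/negP: XA; rewrite -xX; move/subvP: (@ck_A_sub 1 l.+1 (leqW lr)).
  by apply; exact: subvsP.
- have xX : vsval (vsproj (ck_A S 0) X) = X.
    by rewrite vsprojK // ck_A_first memvf.
  split=> //; exists 0%N, (vsproj (ck_A S 0) X); split=> //.
  by rewrite polar_off_A1 ?xX ?subvv.
Qed.

(** At level 1, a point off the quadric spans [ck_A S 1] together with its polar, which would force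
    [H] to be [ck_A S 1]. At deeper levels [Y] lies in the vertex of the quadric, hence on it. *)
Lemma on_quadric_of_total_polar (Y : V) (H : {vspace V}) : (0 < ck_r S)%N ->
  Y \in ck_A S 1 -> total_polar_point S Y H -> H != ck_A S 1 -> Y \in H ->
  exists y : subvs_of (ck_A S 1), on_quadric (ck_form S 1) y /\ vsval y = Y.
Proof.
move=> r0 YA [hH [l [x [lr xY Yl sub]]]] HA YH.
have Y0 : Y != 0 by apply: contraNneq Yl => ->; exact: mem0v.
case: l x lr xY Yl sub => [|[|l]] x lr xY Yl sub; first by rewrite YA in Yl.
- have x0 : x != 0 by apply: contraNneq Y0 => x0; rewrite -xY x0.
  exists x; split=> //; split=> //; apply/eqP; apply: contraNT HA => fx.
  apply/eqP; apply: hyperplane_eq hA1 hH (subv_trans (sub_polar_add fx) _).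
  by rewrite subv_add sub -memvE xY.
have yY : vsval (vsproj (ck_A S 1) Y) = Y by rewrite vsprojK.
exists (vsproj (ck_A S 1) Y); split=> //; split.
  by apply: contraNneq Y0 => y0; rewrite -yY y0.
apply/(ck_A_succP _ r0); rewrite yY -xY.
by move/subvP: (@ck_A_sub 2 l.+2 (leqW lr)); apply; exact: subvsP.
Qed.

(* Any [u] in [A_1] outside the span of [Y] and its polar also lies outside the
   span of these and [X], because [X] is not in [A_1]. *)
Lemma total_polar_on_quadric (X : V) (y : subvs_of (ck_A S 1)) :
  (0 < ck_r S)%N -> X \notin ck_A S 1 -> on_quadric (ck_form S 1) y ->
  exists phi : 'Hom(V, R^o), [/\ total_polar_point S (vsval y) (lker phi),
    phi X = 0, phi (vsval y) = 0 & exists2 u, u \in ck_A S 1 & phi u != 0].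
Proof.
move=> r0 XA [y0 fy].
have Y0 : vsval y != 0 by apply: contra_neq y0 => Y0; apply: subvs_inj; rewrite Y0.
have [l [lr Yl Yl1]] := ck_level Y0.
pose x := vsproj (ck_A S l) (vsval y).
have xY : vsval x = vsval y by rewrite vsprojK.
set Y := vsval y in Y0 Yl Yl1 xY *.
pose Z := (embed (polar (ck_form S l) <[x]>) + <[Y]>)%VS.
have l0 : (0 < l)%N by case: l Yl1 {Yl lr x xY Z} => //; rewrite subvsP.
have Zl : (Z <= ck_A S l)%VS by rewrite subv_add embed_sub -memvE.
have [u uA uZ] : exists2 u, u \in ck_A S 1 & u \notin Z.
  (* If [l = 1], the point lies on the quadric, hence in its own polar, so [Z] is just that polar,
     proper in [ck_A S 1]. If [l > 1], [Z] lies in [ck_A S 2], which is proper in [ck_A S 1]. *)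
  apply/subvPn; move: l0; rewrite leq_eqVlt => /predU1P[l1|l2].
    subst l.
    have Yl2 : vsval x \notin ck_A S 2 by rewrite xY.
    apply: contraNN (polar_proper r0 Yl2) => /subv_trans; apply.
    rewrite subv_add subvv -memvE -xY mem_embed mem_orthov1.
    by rewrite (subvs_inj xY); apply/eqP.
  apply: contraNN (ck_A_proper r0) => /subv_trans/(_ Zl)/subv_trans; apply.
  by apply: ck_A_sub; rewrite l2 leqW.
have uW : u \notin (Z + <[X]>)%VS.
  apply/negP => /memv_addP[z zZ [_ /vlineP[a ->] uE]].
  have zA : z \in ck_A S 1.
    have lA : (ck_A S l <= ck_A S 1)%VS by rewrite ck_A_sub ?l0 ?leqW.
    exact: subvP (subv_trans Zl lA) _ zZ.
  have [a0|a0] := eqVneq a 0.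
    by rewrite uE a0 scale0r addr0 zZ in uZ.
  case/negP: XA; rewrite -[X](scalerK a0) memvZ //.
  have -> : a *: X = u - z by rewrite uE addrC addKr.
  exact: memvB.
have [phi [sub phiu]] := separating_form uW.
move: sub; rewrite !subv_add -!memvE !memv_ker => /andP[/andP[sub /eqP pY] /eqP pX].
exists phi; split=> //; last by exists u.
by split; [exact: hyperplane_lker phiu | exists l, x].
Qed.

(** The adapted basis is [X], [Y]. The forms are independent because [psi] is nonzero and vanishes
    at [X], where [phi] does not. *)
Lemma total_polar_line (L : {vspace V}) (X Y : V) (phi psi : 'Hom(V, R^o)) :
  \dim L = 2%N -> X \in L -> X \notin ck_A S 1 ->
  Y \in L -> Y \in ck_A S 1 -> Y != 0 -> lker phi = ck_A S 1 ->
  total_polar_point S Y (lker psi) -> psi X = 0 ->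
  (exists2 u, u \in ck_A S 1 & psi u != 0) ->
  total_polar S L (lker phi :&: lker psi).
Proof.
move=> dL XL XA YL YA Y0 kphi tY psiX [u uA psiu].
have cA := cap_line_eq dL XL XA YL YA Y0.
have phiX : phi X != 0 by rewrite -memv_ker kphi.
have psi0 : psi != 0 by apply: contraNneq psiu => ->; rewrite zero_lfunE.
have dcap : (2 + \dim (lker phi :&: lker psi))%N = n.+1.
  rewrite !addSn add0n -(dim_cap_lker _ psiu) ?kphi //.
  by case: hA1 => _ <-; rewrite dimvf /dim /= mul1n.
(* From level 1 on, [L] meets the flag only inside [<[Y]>], so [Y] alone accounts for the
   dimension. *)
have cnt j : (j <= ck_r S)%N ->
    ((X \in ck_A S j) + (Y \in ck_A S j))%N = \dim (L :&: ck_A S j).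
  case: j => [|j] jr; first by rewrite !ck_A_first !memvf capvf dL.
  have jA : (ck_A S j.+1 <= ck_A S 1)%VS by apply/ck_A_sub/leqW.
  have -> : (X \in ck_A S j.+1) = false.
    by apply: contraNF XA; move/subvP: jA; apply.
  have -> : (L :&: ck_A S j.+1 = <[Y]> :&: ck_A S j.+1)%VS.
    by rewrite -cA -capvA (capv_idPr jA).
  case: (boolP (Y \in _)) => Yj.
    by rewrite (capv_idPl _) -?memvE // dim_vline Y0.
  apply/esym/eqP; rewrite dimv_eq0 -subv0; apply/subvP => w.
  case/memv_capP => /vlineP[a ->]; rewrite memv0.
  have [-> _|a0 aY] := eqVneq a 0; first by rewrite scale0r.
  by case/negP: Yj; rewrite -[Y](scalerK a0) memvZ.
(* The types of the tuple and the family depend on [\dim L]; generalizing it allows replacing it by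
   2. *)
rewrite /total_polar; move: (\dim L) dL => d ->; split=> //.
exists [tuple X; Y], (fun i => lker (tnth [tuple phi; psi] i)); split.
- split; last by move=> w; rewrite !inE => /orP[]/eqP->.
  rewrite /= free_cons span_seq1 seq1_free Y0 andbT.
  by apply: contraNN XA => /vlineP[a ->]; rewrite memvZ.
- by move=> j jr; rewrite /= addn0 cnt.
- case=> [[|[|//]] i2] /=; rewrite !(tnth_nth 0) //=.
  by apply/total_polar_off_A1.
- exists [tuple phi; psi]; split=> //.
  rewrite /= free_cons span_seq1 seq1_free psi0 andbT.
  apply: contraNN phiX => /vlineP[a ->].
  by rewrite scale_lfunE psiX scaler0.
- by rewrite !big_ord_recl big_ord0 capvf !(tnth_nth 0).
Qed.

End CKSpaces.

(** * Tangent lines through a point off the hyperplane *)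

Theorem proposition4p2 (R : realType) (n : nat) (S : ck_space R n)
    (hA1 : hyperplane_of fullv (ck_A S 1))
    (X : 'rV[R]_n.+1) (hX0 : X != 0) (hX : X \notin ck_A S 1)
    (L : {vspace 'rV[R]_n.+1}) (hL : \dim L = 2%N) (hXL : X \in L) :
  tangent S L <->
  exists Y : subvs_of (ck_A S 1),
    on_quadric (ck_form S 1) Y /\ vsval Y \in L.
Proof.
(* With [ck_r S = 0] the hyperplane [ck_A S 1] would be 0 and the whole space one-dimensional, too
   small to contain [L]. *)
have r0 : (0 < ck_r S)%N.
  rewrite lt0n; apply/eqP => r0; case: hA1; have := ck_A_last S.
  rewrite r0 => -> _ d1; have := dimvS (subvf L).
  by rewrite hL d1 dimv0.
split=> [[P [tP]]|[y [qy yL]]].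
  rewrite -vpick0; set z := vpick _ => z0.
  have /memv_capP[zL zP] : z \in (L :&: P)%VS by exact: memv_pick.
  (* Stated for arbitrary [b] and [c] because the adapted basis may list its two points in either
     order. Since [Hb] is [ck_A S 1], the common point [z] is the point [c], so [c] lies on its own
     total polar [Hc]. *)
  have key b c Hb Hc : b \in L -> b \notin ck_A S 1 -> c \in L ->
      c \in ck_A S 1 -> total_polar_point S b Hb -> total_polar_point S c Hc ->
      Hb != Hc -> z \in Hb -> z \in Hc ->
      exists Y : subvs_of (ck_A S 1),
        on_quadric (ck_form S 1) Y /\ vsval Y \in L.
    move=> bL bA cL cA /(total_polar_off_A1 hA1 _ bA)-> tc HbHc zA zH.
    have c0 : c != 0.
      case: tc => _ [l [x [_ _ cl _]]].
      by apply: contraNneq cl => ->; exact: mem0v.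
    have : z \in (L :&: ck_A S 1)%VS by exact/memv_capP.
    rewrite (cap_line_eq hL bL bA cL cA c0) => /vlineP[a zE].
    have a0 : a != 0 by apply: contraNneq z0 => a0; rewrite zE a0 scale0r.
    have cH : c \in Hc by rewrite -[c](scalerK a0) -zE memvZ.
    rewrite eq_sym in HbHc.
    have [Y [qY YE]] := on_quadric_of_total_polar hA1 r0 cA tc HbHc cH.
    by exists Y; rewrite YE.
  have dLA : \dim (L :&: ck_A S 1) = 1%N.
    have LA0 : (L :&: ck_A S 1)%VS != 0%VS.
      have := dimv_sum_cap L (ck_A S 1); case: hA1 => _ dA.
      have := dimvS (subvf (L + ck_A S 1)); rewrite dA hL => le eq.
      apply: contraTneq le => LA; move: eq; rewrite LA dimv0 addn0 => ->.
      by rewrite -ltnNge.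
    rewrite -vpick0 in LA0; have /memv_capP[vL vA] := memv_pick (L :&: ck_A S 1).
    by rewrite (cap_line_eq hL hXL hX vL vA LA0) dim_vline LA0.
  move: tP; rewrite /total_polar; move: (\dim L) hL => d -> [_ [B [H]]].
  case=> [[fB BL] cnt tB /independent_hyperplanes_neq neq PE].
  have i01 : (ord0 : 'I_2) != ord_max by [].
  have inH i : z \in H i by move: zP; rewrite PE => /subv_bigcapP; exact.
  have inL i : tnth B i \in L by apply/BL/mem_tnth.
  have tE : B = [tuple tnth B ord0; tnth B ord_max].
    apply: eq_from_tnth => -[[|[|//]] i2]; rewrite [RHS](tnth_nth 0) /=;
      by congr tnth; exact: val_inj.
  (* The count at level 1 says that exactly one of the two basis points lies in [ck_A S 1]. *)
  have := cnt _ r0; rewrite {1}tE dLA /= addn0.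
  case: (boolP (tnth B ord0 \in _)) => b0;
    case: (boolP (tnth B ord_max \in _)) => b1 //= _.
    by apply: key (inL _) b1 (inL _) b0 (tB _) (tB _) _ (inH _) (inH _); apply: neq.
  by apply: key (inL _) b0 (inL _) b1 (tB _) (tB _) _ (inH _) (inH _); apply: neq.
have [psi [tY psiX psiY [u uA psiu]]] := total_polar_on_quadric r0 hX qy.
have [phi [kA phiX]] := separating_form hX.
have kphi : lker phi = ck_A S 1.
  exact: hyperplane_eq hA1 (hyperplane_lker phiX) kA.
have Y0 : vsval y != 0.
  by case: qy => y0 _; apply: contra_neq y0 => Y0; apply: subvs_inj; rewrite Y0.
exists (lker phi :&: lker psi)%VS; split.
  apply: (total_polar_line hA1 hL hXL hX yL _ Y0) => //; first exact: subvsP.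
  by exists u.
(* The point of [L] on the quadric lies in both kernels, so it is the required common point. *)
apply: contraNneq Y0 => LP; rewrite -memv0 -LP !memv_cap yL kphi subvsP.
by rewrite memv_ker psiY eqxx.
Qed.
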